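(* Let $N$ be a matroid. For all $\varepsilon > 0$ there exist $\delta > 0$ and $r_0 \in \mathbb{Z}^+$ such that, if $r \ge r_0$ and $M$ is an $N$-free matroid of rank $r$ with $|M| \ge (1-2^{1-\chi(N)} - \delta)2^{r}$, then $|M \,\Delta\, B| < \varepsilon 2^{r}$ for some matroid $B \cong \mathrm{BB}(r-1,2,\chi(N)-1)$.
   Context: A matroid of dimension $m$ is a set $M \subseteq \mathbb{F}_2^m \setminus \{0\}$. Two matroids $M\subseteq\mathbb{F}_2^m$, $M'\subseteq \mathbb{F}_2^m$ are isomorphic if there is a linear bijection $\varphi$ of $\mathbb{F}_2^m$ with $\varphi(M') = M$. A subset of $M \subseteq \mathbb{F}_2^m$ that is the image of $N \subseteq \mathbb{F}_2^k$ under an injective linear map $\mathbb{F}_2^k \to \mathbb{F}_2^m$ is an $N$-restriction of $M$; $M$ is $N$-free if it has no $N$-restriction. The rank $r(M)$ of $M \subseteq \mathbb{F}_2^m$ is the smallest dimension of a subspace of $\mathbb{F}_2^m$ containing $M$. The critical number $\chi(N)$ of $N \subseteq \mathbb{F}_2^k$ is the smallest codimension of a subspace of $\mathbb{F}_2^k$ disjoint from $N$. The Bose-Burton geometry $\mathrm{BB}(r-1,2,s)$ is the $r$-dimensional matroid consisting of the complement in $\mathbb{F}_2^r$ of an $(r-s)$-dimensional subspace. $\Delta$ denotes symmetric difference. *)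

(* Defs.v *)
From mathcomp Require Import all_boot all_order all_algebra.
From mathcomp Require Import boolp reals.

Set Implicit Arguments.
Unset Strict Implicit.
Unset Printing Implicit Defensive.

Import GRing.Theory.
Local Open Scope ring_scope.

Record matroid (m : nat) := Matroid {
  mset :> {set 'rV['F_2]_m};
  mset_notin0 : 0 \notin mset }.

Definition is_restriction (k m : nat) (N : matroid k) (M : matroid m)
    (S : {set 'rV['F_2]_m}) : Prop :=
  S \subset M /\
  exists phi : {linear 'rV['F_2]_k -> 'rV['F_2]_m},
    injective phi /\ S = [set phi x | x in N].

Definition matroid_free (k m : nat) (N : matroid k) (M : matroid m) : Prop :=
  ~ exists S : {set 'rV['F_2]_m}, is_restriction N M S.

Definition matroid_iso (m : nat) (M M' : matroid m) : Prop :=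
  exists phi : {linear 'rV['F_2]_m -> 'rV['F_2]_m},
    bijective phi /\ [set phi x | x in M'] = M.

Definition is_spanning_dim (m : nat) (M : matroid m) (d : nat) : Prop :=
  exists U : {vspace 'rV['F_2]_m}, \dim U = d /\ {subset M <= U}.

Lemma ex_spanning_dim (m : nat) (M : matroid m) :
  exists d, `[< is_spanning_dim M d >].
Proof.
exists (\dim (fullv : {vspace 'rV['F_2]_m})); apply/asboolP.
by exists fullv; split=> // v _; rewrite memvf.
Qed.

Definition rank (m : nat) (M : matroid m) : nat := ex_minn (ex_spanning_dim M).

Definition is_disjoint_codim (k : nat) (N : matroid k) (c : nat) : Prop :=
  exists U : {vspace 'rV['F_2]_k},
    (k - \dim U)%N = c /\ forall x, x \in N -> x \notin U.

Lemma ex_disjoint_codim (k : nat) (N : matroid k) :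
  exists c, `[< is_disjoint_codim N c >].
Proof.
exists (k - \dim (0%VS : {vspace 'rV['F_2]_k}))%N; apply/asboolP.
exists 0%VS; split=> // x xN; rewrite memv0.
by apply: contraNneq (mset_notin0 N) => <-.
Qed.

Definition critical_number (k : nat) (N : matroid k) : nat :=
  ex_minn (ex_disjoint_codim N).

(* [is_bose_burton s B], for B of dimension r, says that B is a copy of
   BB(r-1,2,s): the complement of a subspace of dimension r - s.  There is no
   such B when r < s. *)
Definition is_bose_burton (r s : nat) (B : matroid r) : Prop :=
  exists U : {vspace 'rV['F_2]_r},
    (\dim U + s)%N = r /\ mset B = [set x | x \notin U].

Definition symdiff (T : finType) (A B : {set T}) : {set T} :=
  (A :\: B) :|: (B :\: A).

(* Main.v *)
Require Import Defs.
From mathcomp Require Import all_boot all_order all_algebra finfield zify.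
From mathcomp Require Import boolp reals lra.

Set Implicit Arguments.
Unset Strict Implicit.
Unset Printing Implicit Defensive.

Import Order.TTheory GRing.Theory Num.Theory.
Local Open Scope ring_scope.

(** Put [c = chi(N) - 1] and let [D] be the complement of [M], inside the span
    [V] of [M]; the density hypothesis reads [|D| <= (2^-c + delta) |V|].
    As [N] avoids a subspace of codimension [c + 1], [M] contains no blow-up:
    there are no [X] of dimension [c + 1] and [U] of dimension [dim N - c - 1]
    with [x + U] inside [M] for all nonzero [x] in [X].

    A dense set contains affine subspaces of any fixed dimension.  So if [M]
    blows up [X] over a large [U] and a positive proportion of the translates
    of [X] lie in [M], then [M] blows up some [X + <h>] over a smaller [U'].
    Starting from a single point [p], the density of [M] allows this to be
    iterated up to dimension [c]; this works for all but few [p] in [M].  For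
    such a [p], [X] of dimension [c] contains [p] and, [M] having no blow-up of
    dimension [c + 1], almost every translate of [X] meets [D].  As
    [|X| |D|] is about [|V|], almost every translate meets [D] exactly once, so
    [D] and [D + p] are almost disjoint.

    Therefore a sum of two elements of [D] is rarely in [M]: [D] is almost
    closed under addition, hence close to a subspace, whose codimension is [c]
    by cardinality. *)

Lemma card_sum_mem (T : finType) (A : {set T}) : #|A| = (\sum_x (x \in A))%N.
Proof. by rewrite -sum1_card big_mkcond; apply: eq_bigr => x _; case: ifP. Qed.

Lemma symdiffC (T : finType) (A B : {set T}) : symdiff A B = symdiff B A.
Proof. exact: setUC. Qed.

Lemma symdiff_setC (T : finType) (A B : {set T}) :
  symdiff (~: A) (~: B) = symdiff A B.
Proof. by rewrite symdiffC /symdiff !setDE !setCK ![~: _ :&: _]setIC. Qed.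

Lemma leq_card_symdiff (T : finType) (A B : {set T}) :
  (#|A| <= #|B| + #|symdiff A B|)%N.
Proof.
rewrite -(cardsID B A) leq_add ?subset_leq_card ?subsetIr //.
exact: subsetUl.
Qed.

Lemma symdiff_imset (aT rT : finType) (f : aT -> rT) (A B : {set aT}) :
  injective f -> symdiff (f @: A) (f @: B) = f @: symdiff A B.
Proof.
move=> f_inj; have imsetD (C D : {set aT}) : f @: C :\: f @: D = f @: (C :\: D).
  apply/setP=> y; apply/setDP/imsetP => [[/imsetP[x xC ->]]|[x /setDP[xC xD] ->]].
    by rewrite mem_imset // => xD; exists x; rewrite ?inE ?xD.
  by rewrite !mem_imset.
by rewrite /symdiff imsetU !imsetD.
Qed.

Section FiniteAbelianGroup.
Variable G : finZmodType.
Implicit Types (x y z h : G) (A M : {set G}) (X Y : {pred G}).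

Definition self_overlap A y := [set x in A | x + y \in A].

Definition diffset A := [set x - y | x in A, y in A].

Definition translates_in M X := [set h | [forall x in X, h + x \in M]].

Lemma translates_inP M X h :
  reflect {in X, forall x, h + x \in M} (h \in translates_in M X).
Proof. by rewrite inE; apply: forall_inP. Qed.

Lemma self_overlapE A y : self_overlap A y = translates_in A (pred2 0 y).
Proof.
apply/setP=> x; rewrite inE; apply/andP/translates_inP => [[xA xyA] z|hA].
  by case/pred2P=> ->; rewrite ?addr0.
by rewrite -{1}[x]addr0 !hA ?inE ?eqxx ?orbT.
Qed.

Lemma card_self_overlap A y : (#|self_overlap A y| <= #|A|)%N.
Proof. by apply/subset_leq_card/subsetP=> x; rewrite inE => /andP[]. Qed.

Lemma mem_diffset A y : (y \in diffset A) = (0 < #|self_overlap A y|)%N.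
Proof.
rewrite card_gt0; apply/imset2P/set0Pn => [[x z xA zA ->]|[z]].
  by exists z; rewrite inE zA addrC subrK.
by rewrite inE => /andP[zA zyA]; exists (z + y) z; rewrite // addrAC subrr add0r.
Qed.

Lemma sum_card_translate A X :
  (\sum_h #|[set x in X | (h + x \in A)%R]| = #|X| * #|A|)%N.
Proof.
have -> : (\sum_h #|[set x in X | (h + x \in A)%R]|
           = \sum_h \sum_(x in X) (h + x \in A)%R)%N.
  apply: eq_bigr => h _; rewrite -sum1dep_card big_mkcondr /=.
  by apply: eq_bigr => x _; case: (_ \in A).
rewrite exchange_big /= -sum_nat_const; apply: eq_bigr => x _.
rewrite (reindex_inj (addIr (- x))) card_sum_mem.
by apply: eq_bigr => h _; rewrite subrK.
Qed.

Lemma sum_self_overlap A : (\sum_y #|self_overlap A y| = #|A| ^ 2)%N.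
Proof.
rewrite -mulnn -(sum_card_translate A (mem A)); apply: eq_bigr => y _.
by apply: eq_card => x; rewrite !inE addrC.
Qed.

Lemma dense_translate q A X : (#|G| <= q * #|A|)%N ->
  exists h, (#|X| <= q * #|[set x in X | (h + x \in A)%R]|)%N.
Proof.
move=> A_dense; apply/existsP; apply: contraT; rewrite negb_exists.
move=> /forallP sparse; pose f h := #|[set x in X | (h + x \in A)%R]|.
have : (\sum_h (q * f h).+1 <= \sum_(h : G) #|X|)%N.
  by apply: leq_sum => h _; rewrite ltnNge sparse.
under eq_bigr do rewrite -addn1.
rewrite big_split /= -big_distrr /= sum_card_translate.
rewrite !sum_nat_const muln1 -[#|xpredT|]/#|G|.
have : (0 < #|G|)%N by apply/card_gt0P; exists 0.
have : (#|G| * #|X| <= q * #|A| * #|X|)%N by rewrite leq_mul2r A_dense orbT.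
by rewrite -mulnA [(#|A| * _)%N]mulnC; lia.
Qed.

(* The [y] in [X] account for at most [#|X| * #|A|] of the [#|A| ^ 2] pairs. *)
Lemma popular_difference A X : (2 * #|X| < #|A|)%N ->
  exists y, [/\ y \in diffset A, y \notin X
    & #|A| ^ 2 <= 2 * #|diffset A| * #|self_overlap A y|]%N.
Proof.
move=> X_small.
suff: [exists y, [&& y \in diffset A, y \notin X
    & #|A| ^ 2 <= 2 * #|diffset A| * #|self_overlap A y|]%N].
  by case/existsP=> y /and3P[]; exists y.
apply: contraT; rewrite negb_exists => /forallP unpopular.
have overlap_X : (\sum_(y in X) #|self_overlap A y| <= #|X| * #|A|)%N.
  by rewrite -sum_nat_const; apply: leq_sum => y _; apply: card_self_overlap.
have overlap_notX : (2 * #|diffset A| * \sum_(y | y \notin X) #|self_overlap A y|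
                      <= #|diffset A| * #|A| ^ 2)%N.
  rewrite big_distrr /= -sum_nat_const big_mkcond [leqRHS]big_mkcond /=.
  apply: leq_sum => y _; have := unpopular y; rewrite mem_diffset lt0n.
  case: eqP => [->|_] /=; first by rewrite muln0; case: ifP.
  by case: (y \in X) => //=; rewrite -ltnNge => /ltnW.
have A_gt0 : (0 < #|A|)%N by apply: leq_ltn_trans X_small.
have diffset_gt0 : (0 < #|diffset A|)%N.
  have /card_gt0P[x xA] := A_gt0.
  by apply/card_gt0P; exists (x - x); apply: imset2_f.
move: overlap_notX; rewrite mulnAC mulnC leq_pmul2l // => overlap_notX.
have : (2 * (#|X| * #|A|) < #|A| ^ 2)%N by rewrite mulnA -mulnn ltn_pmul2r.
move: overlap_X overlap_notX; have := sum_self_overlap A; rewrite (bigID [in X]) /=.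
by move: (\sum_(y in X) _)%N (\sum_(y | y \notin X) _)%N => overX overnX; lia.
Qed.

(* A point [h] outside [translates_in M X] is counted in [#|X| * #|~: M|] once
   for each [x] in [X] with [h + x] outside [M]: at least once, and at least
   [#|Y|] times if the whole of [h + Y] is outside [M]. *)
Lemma card_translates_in_sub M X Y : Y \subset X ->
  (#|Y|.-1 * #|translates_in (~: M) Y| + #|G|
     <= #|X| * #|~: M| + #|translates_in M X|)%N.
Proof.
move=> YX; rewrite -sum_card_translate !card_sum_mem -[#|G|]sum1_card big_distrr.
rewrite -!big_split /=; apply: leq_sum => h _.
set missed := [set x in X | h + x \in ~: M].
have Y_missed : h \in translates_in (~: M) Y -> Y \subset missed.
  move=> /translates_inP hY; apply/subsetP=> y yY.
  by rewrite inE hY // (subsetP YX).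
have [missed0|missed_neq0] := posnP #|missed|.
  have -> : h \in translates_in M X.
    apply/translates_inP => x xX; apply: contraT => hxM.
    by have := card0_eq missed0 x; rewrite inE xX in_setC hxM.
  by case: (boolP (h \in _)) => [/Y_missed/subset_leq_card|_] /=; lia.
apply: leq_trans (leq_addr _ _).
have [/Y_missed/subset_leq_card|_] := boolP (h \in _); rewrite ?muln0 addn1 //.
by rewrite muln1; case: #|Y|.
Qed.

Lemma card_translates_in M X :
  (#|G| <= #|X| * #|~: M| + #|translates_in M X|)%N.
Proof.
have := @card_translates_in_sub M X pred0; rewrite card0 mul0n add0n; apply.
exact/subsetP.
Qed.

Lemma self_overlap_translates_in M X p : 0 \in X -> p \in X -> p != 0 ->
  (#|self_overlap (~: M) p| + #|G| <= #|X| * #|~: M| + #|translates_in M X|)%N.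
Proof.
move=> X0 Xp p_neq0; have := @card_translates_in_sub M X (pred2 0 p).
rewrite card2 eq_sym p_neq0 mul1n -self_overlapE; apply.
by apply/subsetP=> x /pred2P[]->.
Qed.

Lemma self_overlapB A y z :
  (#|self_overlap A y| + #|self_overlap A z|
     <= #|A| + #|self_overlap A (y - z)%R|)%N.
Proof.
rewrite -cardsUI; apply: leq_add.
  by apply/subset_leq_card/subsetP=> x; rewrite !inE => /orP[]/andP[].
rewrite -(card_imset _ (addIr z)).
apply/subset_leq_card/subsetP=> _ /imsetP[x + ->].
by rewrite !inE addrACA subrr addr0 => /andP[/andP[_ ->] /andP[_ ->]].
Qed.

Lemma card_self_overlap_diffset A y : y \in diffset A ->
  (2 * #|A| <= #|diffset A| + #|self_overlap A y|)%N.
Proof.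
case/imset2P=> a b aA bA ->; rewrite mul2n -addnn.
rewrite -{1}(card_imset A (addIr (- a))) -(card_imset A (addIr (- b))) -cardsUI.
apply: leq_add.
  by apply/subset_leq_card/subsetP=> _ /setUP[]/imsetP[x xA ->]; apply: imset2_f.
rewrite -[leqLHS](card_imset _ (addIr b)).
apply/subset_leq_card/subsetP=> _ /imsetP[_ /setIP[/imsetP[x xA ->] + ] ->].
case/imsetP=> x' xA' xx'.
by rewrite inE {1}xx' addrACA subrr addr0 !addrNK xA xA'.
Qed.

(* Freiman's 3/2 theorem. *)
Lemma small_doubling_subr_closed A : (2 * #|diffset A| < 3 * #|A|)%N ->
  {in diffset A &, forall y z, y - z \in diffset A}.
Proof.
move=> small y z yA zA; rewrite mem_diffset.
have := self_overlapB A y z.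
have := (card_self_overlap_diffset yA, card_self_overlap_diffset zA).
by case; lia.
Qed.

End FiniteAbelianGroup.

Arguments translates_inP {G M X h}.

Section AlmostPeriods.
Variables (R : realDomainType) (G : finZmodType) (D : {set G}) (t : R).

Definition almost_periods := [set z in D | #|D|%:R <= #|self_overlap D z|%:R + t].

Lemma almost_periods_sub : almost_periods \subset D.
Proof. by apply/subsetP=> z /setIdP[]. Qed.

Lemma almost_periods0 : 0 <= t -> 0 \in D -> 0 \in almost_periods.
Proof.
move=> t_ge0 D0; rewrite inE D0 (_ : self_overlap D 0 = D) ?lerDl //.
by apply/setP=> x; rewrite inE addr0 andbb.
Qed.

Lemma overlap_almost_periodsB y z : y \in almost_periods -> z \in almost_periods ->
  #|D|%:R <= #|self_overlap D (y - z)|%:R + 2 * t.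
Proof.
move=> /setIdP[_ y_period] /setIdP[_ z_period].
by have := self_overlapB D y z; rewrite -(ler_nat R) !natrD; lra.
Qed.

(* Markov's inequality for the defect [#|D| - #|self_overlap D z|], whose sum
   over [D] is the sum of the overlaps outside [D]. *)
Lemma card_not_almost_periods :
  #|D :\: almost_periods|%:R * t <= (\sum_(z | z \notin D) #|self_overlap D z|)%:R.
Proof.
set P := D :\: almost_periods.
have defect z : z \in D -> (z \in P)%:R * t <= #|D|%:R - #|self_overlap D z|%:R.
  move=> zD; have [|_] := boolP (z \in P).
    by rewrite !inE zD andbT -ltNge /=; lra.
  by rewrite mul0r subr_ge0 ler_nat card_self_overlap.
have -> : (#|P| = \sum_(z in D) (z \in P))%N.
  rewrite card_sum_mem [RHS]big_mkcond; apply: eq_bigr => z _.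
  by rewrite !inE; case: (z \in D); rewrite ?andbF.
rewrite natr_sum mulr_suml (le_trans (ler_sum _ defect)) //.
rewrite sumrB sumr_const -mulrnA mulnn -natr_sum.
have := sum_self_overlap D; rewrite (bigID [in D]) /= => <-.
by rewrite natrD; lra.
Qed.

End AlmostPeriods.

Section NearSubgroup.
Variables (R : realFieldType) (G : finZmodType) (D E : {set G}) (e : R).
Let g : R := #|G|%:R.
Hypotheses (e_gt0 : 0 < e) (D0 : 0 \in D) (D_large : 10 * (e * g) <= #|D|%:R)
  (E_small : #|E|%:R <= e ^+ 2 * g).
Hypothesis unpopular_outside : forall p, p \notin D -> p \notin E ->
  #|self_overlap D p|%:R <= e ^+ 2 * g.

Let g_gt0 : 0 < g.
Proof. by rewrite ltr0n; apply/card_gt0P; exists 0. Qed.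

Let eg_gt0 : 0 < e * g.
Proof. exact: mulr_gt0. Qed.

Let esqr_le : e ^+ 2 * g <= e * g.
Proof.
have card_D : #|D|%:R <= g by rewrite ler_nat max_card.
have e_le1 : e <= 1.
  by rewrite -(ler_pM2r g_gt0) mul1r; move: D_large eg_gt0; lra.
by rewrite ler_pM2r // expr2 ler_piMr // ltW.
Qed.

Lemma sum_overlap_outside :
  (\sum_(z | z \notin D) #|self_overlap D z|)%:R <= 2 * (e * g) ^+ 2.
Proof.
have overlap_le z : z \notin D ->
    #|self_overlap D z|%:R <= e ^+ 2 * g + (z \in E)%:R * g.
  move=> zD; have [zE|/(unpopular_outside zD)] := boolP (z \in E).
    by rewrite mul1r ler_wpDl ?ler_nat ?max_card // mulr_ge0 ?sqr_ge0 ?ltW.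
  by rewrite mul0r addr0.
have bound_ge0 (z : G) : 0 <= e ^+ 2 * g + (z \in E)%:R * g.
  by rewrite addr_ge0 ?mulr_ge0 ?sqr_ge0 ?ler0n ?ltW.
rewrite natr_sum; apply: (@le_trans _ _ (\sum_z (e ^+ 2 * g + (z \in E)%:R * g))).
  rewrite big_mkcond /=; apply: ler_sum => z _.
  by case: ifP => // /overlap_le.
rewrite big_split /= sumr_const -mulr_natl -/g -big_distrl /= -natr_sum.
rewrite -card_sum_mem.
by have := ler_wpM2r (ltW g_gt0) E_small; rewrite exprMn; lra.
Qed.

Let S := diffset (almost_periods D (e * g)).

Lemma diffset_almost_periods : S \subset D :|: E.
Proof.
apply/subsetP=> _ /imset2P[y z y_period z_period ->].
rewrite in_setU; apply: contraT => /norP[yzD yzE].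
have := overlap_almost_periodsB y_period z_period.
by have := unpopular_outside yzD yzE; move: D_large esqr_le eg_gt0; lra.
Qed.

(* Most of [D] consists of almost periods, while their differences are confined
   to [D :|: E]: the almost periods have doubling less than 3/2. *)
Lemma near_subgroup : exists H : {set G},
  [/\ 0 \in H, {in H &, forall y z, y - z \in H}
    & #|symdiff D H|%:R <= 3 * (e * g)].
Proof.
set P := almost_periods D (e * g).
have most_periods : #|D :\: P|%:R <= 2 * (e * g).
  rewrite -(ler_pM2r eg_gt0) -mulrA -expr2.
  exact: le_trans (card_not_almost_periods D (e * g)) sum_overlap_outside.
have PS : P \subset S.
  apply/subsetP=> x xP; apply/imset2P.
  by exists x 0; rewrite ?subr0 ?almost_periods0 ?ltW.
have card_D : #|D|%:R = #|P|%:R + #|D :\: P|%:R :> R.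
  by rewrite -natrD -(cardsID P D) (setIidPr (almost_periods_sub _ _)).
have card_S : #|S|%:R <= #|D|%:R + #|E|%:R :> R.
  rewrite -natrD ler_nat (leq_trans _ (leq_card_setU D E)) //.
  exact: subset_leq_card diffset_almost_periods.
exists S; split.
- by rewrite (subsetP PS) // almost_periods0 // ltW.
- apply: small_doubling_subr_closed; rewrite -(ltr_nat R) !natrM -/P.
  by move: most_periods D_large E_small esqr_le eg_gt0; lra.
- have D_minus_S : #|D :\: S|%:R <= 2 * (e * g).
    by apply: le_trans most_periods; rewrite ler_nat subset_leq_card // setDS.
  have S_minus_D : #|S :\: D|%:R <= e * g.
    apply: le_trans (le_trans E_small esqr_le); rewrite ler_nat subset_leq_card //.
    by rewrite subDset diffset_almost_periods.
  have : #|symdiff D S|%:R <= #|D :\: S|%:R + #|S :\: D|%:R :> R.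
    by rewrite -natrD ler_nat leq_card_setU.
  by lra.
Qed.

End NearSubgroup.

Section LinearAlgebra.
Variables (K : fieldType) (vT wT : vectType K).
Implicit Types (A B C U W : {vspace vT}) (w : vT).

Lemma capv_vline_eq0 U w : w \notin U -> (U :&: <[w]> = 0)%VS.
Proof.
move=> wU; apply/eqP; rewrite -subv0; apply/subvP => v.
case/memv_capP=> vU /vlineP[a v_eq]; move: vU; rewrite {v}v_eq.
have [->|a_neq0] := eqVneq a 0; first by rewrite scale0r !mem0v.
by move/(memvZ a^-1); rewrite scalerK // (negbTE wU).
Qed.

Lemma dim_add_vline U w : w \notin U -> \dim (U + <[w]>) = (\dim U).+1.
Proof.
move=> wU; rewrite dimv_disjoint_sum ?capv_vline_eq0 // dim_vline.
by rewrite (_ : w != 0) ?addn1 //; apply: contraNneq wU => ->; rewrite mem0v.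
Qed.

Lemma capv_add_exchange A B C :
  (B :&: C = 0)%VS -> (A :&: (B + C) = 0)%VS -> ((A + C) :&: B = 0)%VS.
Proof.
move=> BC0 ABC0; apply/eqP; rewrite -dimv_eq0 -(eqn_add2l (\dim (A + C + B))).
have AC0 : (A :&: C = 0)%VS.
  by apply/eqP; rewrite -subv0 -ABC0 capvS // addvSr.
rewrite dimv_sum_cap addn0 -addvA [(C + B)%VS]addvC.
by rewrite !dimv_disjoint_sum // addnAC addnA.
Qed.

Lemma exists_subv_dim U d : (d <= \dim U)%N -> exists2 W, (W <= U)%VS & \dim W = d.
Proof.
move=> d_le; exists <<take d (vbasis U)>>%VS.
  by apply/span_subvP => v /mem_take/vbasis_mem.
have := basis_free (vbasisP U).
rewrite -{1}(cat_take_drop d (vbasis U)) => /catl_free.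
by rewrite /free size_takel ?size_tuple // => /eqP.
Qed.

Lemma exists_lfun_direct_sum A1 A2 (B1 B2 : {vspace wT}) :
    (A1 :&: A2 = 0)%VS -> \dim A1 = \dim B1 -> \dim A2 = \dim B2 ->
  exists f : 'Hom(vT, wT), (f @: A1 = B1)%VS /\ (f @: A2 = B2)%VS.
Proof.
move=> A0 dimA1 dimA2.
have free_basisA : free (vbasis A1 ++ vbasis A2).
  apply: (basis_free (U := (A1 + A2)%VS)).
  by apply: cat_basis; rewrite ?vbasisP //; apply/directv_addP.
have eq_size : size (vbasis B1 ++ vbasis B2) = size (vbasis A1 ++ vbasis A2).
  by rewrite !size_cat !size_tuple dimA1 dimA2.
have [f /(_ free_basisA eq_size)/eqP] :=
  linear_of_free (vbasis A1 ++ vbasis A2) (vbasis B1 ++ vbasis B2).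
rewrite map_cat eqseq_cat ?size_map ?size_tuple // => /andP[/eqP f1 /eqP f2].
exists (linfun f).
rewrite -(span_basis (vbasisP A1)) -(span_basis (vbasisP A2)) !limg_span.
by rewrite !(eq_map (lfunE f)) f1 f2 !(span_basis (vbasisP _)).
Qed.

Lemma exists_lfun_img A (B : {vspace wT}) :
  \dim A = \dim B -> exists f : 'Hom(vT, wT), (f @: A)%VS = B.
Proof.
move=> dimA.
have [|f [fA _]] := @exists_lfun_direct_sum A 0%VS B 0%VS (capv0 A) dimA.
  by rewrite !dimv0.
by exists f.
Qed.

Lemma lker0_dim (f : 'Hom(vT, wT)) :
  (lker f == 0%VS) = (\dim (limg f) == \dim {: vT}).
Proof.
rewrite -(limg_ker_dim f fullv) capfv -dimv_eq0.
by rewrite -{1}[\dim (limg f)]add0n eqn_add2r eq_sym.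
Qed.

End LinearAlgebra.

Lemma dim_rVfull (K : fieldType) n : \dim {: 'rV[K]_n} = n.
Proof. by rewrite dimvf /dim /= mul1n. Qed.

Section BinarySpace.
Variable V : vectType 'F_2.
Implicit Types (v w : V) (U : {vspace V}).

Lemma vlineF2P v w : reflect (v = 0 \/ v = w) (v \in <[w]>%VS).
Proof.
apply: (iffP (vlineP _ _)) => [[a ->]|[]->].
- have [->|a_neq0] := eqVneq a 0; first by rewrite scale0r; left.
  suff -> : a = 1 by rewrite scale1r; right.
  by apply/val_inj; case: a a_neq0 => [[|[|[]]]].
- by exists 0; rewrite scale0r.
- by exists 1; rewrite scale1r.
Qed.

Lemma memv_add_vlineF2 U v w : (v \in U + <[w]>)%VS = (v \in U) || (v - w \in U).
Proof.
apply/memv_addP/orP => [[u uU [_ /vlineF2P[]-> ->]]|[vU|vwU]].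
- by rewrite addr0; left.
- by rewrite addrK; right.
- by exists v => //; exists 0; rewrite ?mem0v ?addr0.
- by exists (v - w) => //; exists w; rewrite ?memv_line ?addrNK.
Qed.

End BinarySpace.

Section BinaryRowSpace.
Variable n : nat.
Implicit Type U : {vspace 'rV['F_2]_n}.

Lemma card_vspaceF2 U : #|U| = (2 ^ \dim U)%N.
Proof. by rewrite card_vspace card_Fp. Qed.

Lemma card_rVF2 : #|{: 'rV['F_2]_n}| = (2 ^ n)%N.
Proof. by rewrite card_mx card_Fp // mul1n. Qed.

Lemma dimv_of_card U c :
  (2 ^ n < 2 * (2 ^ c * #|U|))%N -> (2 ^ c * #|U| < 2 * 2 ^ n)%N ->
  (\dim U + c = n)%N.
Proof.
rewrite card_vspaceF2 -!expnD -!expnS !ltn_exp2l // => dim_ge dim_le.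
by apply/eqP; rewrite eqn_leq addnC -ltnS dim_le.
Qed.

End BinaryRowSpace.

Lemma vspace_of_subr_closed p n (S : {set 'rV['F_p]_n}) :
    0 \in S -> {in S &, forall x y, x - y \in S} ->
  exists L : {vspace 'rV['F_p]_n}, S = [set x in L].
Proof.
move=> S0 SB.
have SD : {in S &, forall x y, x + y \in S}.
  by move=> x y xS yS; rewrite -[y]opprK -[- y]sub0r !SB.
exists <<enum S>>%VS; apply/setP=> x; rewrite inE; apply/idP/idP => [xS|xL].
  by apply: memv_span; rewrite mem_enum.
rewrite (@coord_span _ _ _ (in_tuple (enum S)) x xL).
apply: (big_ind (fun z => z \in S)) => // i _.
have iS : (in_tuple (enum S))`_i \in S by rewrite -mem_enum mem_nth.
rewrite -[coord _ _ _]natr_Zp scaler_nat.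
by elim: (nat_of_ord (coord _ _ _)) => [|m IHm]; rewrite ?mulr0n // mulrS SD.
Qed.

(* [X] records the directions already used in the induction, so that each new
   popular difference raises the dimension. *)
Lemma dense_affine_subspace_avoiding t q s : exists d0, forall n
    (A : {set 'rV['F_2]_n}) (U X : {vspace 'rV['F_2]_n}),
    (d0 <= \dim U)%N -> {subset A <= U} -> (#|U| <= q * #|A|)%N -> (\dim X <= s)%N ->
  exists (a : 'rV['F_2]_n) (W : {vspace 'rV['F_2]_n}),
    [/\ (W <= U)%VS, (W :&: X = 0)%VS, \dim W = t & a \in translates_in A W].
Proof.
elim: t q s => [|t IH] q s.
  exists 0%N => n A U X _ AU A_dense _.
  have /card_gt0P[a aA] : (0 < #|A|)%N.
    by case: #|A| A_dense => //; rewrite muln0 leqn0 card_vspaceF2 expn_eq0.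
  exists a, 0%VS; split; rewrite ?sub0v ?cap0v ?dimv0 //.
  by apply/translates_inP => u; rewrite memv0 => /eqP->; rewrite addr0.
have [d0 IHd0] := IH (2 * q ^ 2)%N s.+1.
exists (maxn d0 (2 * q * 2 ^ s)) => n A U X; rewrite geq_max.
move=> /andP[d0U sU] AU A_dense dimX.
have diffset_sub : diffset A \subset U.
  by apply/subsetP=> _ /imset2P[x y /AU xU /AU yU ->]; apply: memvB.
have X_small : (2 * #|X| < #|A|)%N.
  have : (q * (2 * #|X|) < q * #|A|)%N.
    apply: leq_trans A_dense; rewrite mulnCA mulnA !card_vspaceF2.
    apply: leq_ltn_trans (leq_trans _ sU) (ltn_expl _ _) => //.
    by rewrite leq_mul // leq_exp2l.
  by rewrite ltn_mul2l => /andP[].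
have [y [y_diff yX y_popular]] := popular_difference X_small.
have [|||a [W [WU WX dimW aW]]] := IHd0 n (self_overlap A y) U (X + <[y]>)%VS d0U.
- by move=> x /setIdP[/AU].
- have := subset_leq_card diffset_sub; move: A_dense y_popular.
  have : (0 < #|U|)%N by rewrite card_vspaceF2 expn_gt0.
  move: #|U| #|A| #|diffset A| #|self_overlap A y| => u a d o; nia.
- by rewrite dim_add_vline.
exists a, (W + <[y]>)%VS; split.
- by rewrite subv_add WU -memvE (subsetP diffset_sub).
- by apply: capv_add_exchange WX; apply: capv_vline_eq0.
- rewrite dim_add_vline ?dimW //; apply: contra yX => yW.
  suff /eqP-> : y == 0 by rewrite mem0v.
  by rewrite -memv0 -WX memv_cap yW (subvP (addvSr X _)) ?memv_line.
apply/translates_inP => w; rewrite memv_add_vlineF2 => /orP[] wW;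
  have /setIdP[awA awyA] := translates_inP aW _ wW => //.
by rewrite -[w](addrNK y) addrA.
Qed.

Lemma dense_affine_subspace t q : exists d0, forall n (A : {set 'rV['F_2]_n})
    (U : {vspace 'rV['F_2]_n}),
    (d0 <= \dim U)%N -> {subset A <= U} -> (#|U| <= q * #|A|)%N ->
  exists (a : 'rV['F_2]_n) (W : {vspace 'rV['F_2]_n}),
    [/\ (W <= U)%VS, \dim W = t & a \in translates_in A W].
Proof.
have [d0 d0P] := dense_affine_subspace_avoiding t q 0; exists d0 => n A U d0U AU A_dense.
have [|a [W [WU _ dimW aW]]] := d0P n A U 0%VS d0U AU A_dense.
  by rewrite dimv0.
by exists a, W.
Qed.

Section Blowup.
Variable n : nat.
Notation V := 'rV['F_2]_n.
Implicit Types (h p x u : V) (M : {set V}) (U W X : {vspace V}).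

(* If [0 \notin M], then [M] contains the Bose-Burton geometry [(X + U) :\: U]. *)
Definition blowup M X U :=
  forall x u, x \in X -> x != 0 -> u \in U -> x + u \in M.

Definition blowup_free M d t :=
  forall X U, \dim X = d -> (t <= \dim U)%N -> ~ blowup M X U.

Definition ordinary_point M c q p :=
  exists X, [/\ p \in X, \dim X = c & (q * #|translates_in M X| <= 2 ^ n)%N].

Lemma blowup_cap M X U : 0 \notin M -> blowup M X U -> (X :&: U = 0)%VS.
Proof.
move=> M0 MXU; apply/eqP; rewrite -subv0; apply/subvP=> x /memv_capP[xX xU].
by rewrite memv0; apply: contraNT M0 => x0; rewrite -(subrr x) MXU ?memvN.
Qed.

Lemma blowup_free_gt0 M d t : (t <= n)%N -> blowup_free M d t -> (0 < d)%N.
Proof.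
move=> tn Mfree; rewrite lt0n; apply/eqP => d0.
apply: (Mfree 0%VS fullv); rewrite ?dimv0 ?dim_rVfull //.
by move=> x u; rewrite memv0 => ->.
Qed.

Lemma blowup_add_vline M X U W h : 0 \notin M -> blowup M X U -> (W <= U)%VS ->
    h \in translates_in (translates_in M X) W ->
  h \notin X /\ blowup M (X + <[h]>)%VS W.
Proof.
move=> M0 MXU WU /translates_inP hW; split.
  apply: contra M0 => hX; have /translates_inP/(_ (- h)) := hW 0 (mem0v _).
  by rewrite addr0 subrr memvN hX => ->.
move=> x u; rewrite memv_add_vlineF2 => /orP[xX x_neq0 uW|xhX _ uW].
  by apply: MXU => //; apply: subvP uW.
have /translates_inP/(_ _ xhX) := hW u uW.
by rewrite addrC addrA addrNK.
Qed.

End Blowup.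

Lemma blowup_extend t q : exists d0, forall n (M : {set 'rV['F_2]_n})
    (X U : {vspace 'rV['F_2]_n}), 0 \notin M -> blowup M X U ->
    (d0 <= \dim U)%N -> (2 ^ n <= q * #|translates_in M X|)%N ->
  exists X' U' : {vspace 'rV['F_2]_n},
    [/\ (X <= X')%VS, \dim X' = (\dim X).+1, \dim U' = t & blowup M X' U'].
Proof.
have [d0 d0P] := dense_affine_subspace t q.
exists d0 => n M X U M0 MXU d0U X_popular.
have [|h A_dense] := @dense_translate _ q (translates_in M X) U.
  by rewrite card_rVF2.
set A := [set u in U | _] in A_dense.
have AU : {subset A <= U} by move=> u /setIdP[].
have [a [W [WU dimW aW]]] := d0P n A U d0U AU A_dense.
have haW : h + a \in translates_in (translates_in M X) W.
  apply/translates_inP => w wW; rewrite -addrA.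
  by have /setIdP[] := translates_inP aW w wW.
have [haX MXW] := blowup_add_vline M0 MXU WU haW.
by exists (X + <[h + a]>)%VS, W; rewrite addvSl dim_add_vline.
Qed.

Lemma blowup_extend_iter j t : exists d0, forall n (M : {set 'rV['F_2]_n})
    (X U : {vspace 'rV['F_2]_n}), 0 \notin M -> blowup M X U ->
    (d0 <= \dim U)%N ->
    (2 * 2 ^ (\dim X + j) * #|~: M| <= 3 * 2 ^ n)%N ->
  exists X' U' : {vspace 'rV['F_2]_n},
    [/\ (X <= X')%VS, \dim X' = (\dim X + j)%N, (t <= \dim U')%N & blowup M X' U'].
Proof.
elim: j => [|j [d1 d1P]].
  by exists t => n M X U _ MXU tU _; exists X, U; rewrite addn0.
have [d0 d0P] := blowup_extend d1 4.
exists d0 => n M X U M0 MXU d0U M_dense.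
have [|X1 [U1 [XX1 dimX1 dimU1 MX1]]] := d0P n M X U M0 MXU d0U.
  have := card_translates_in M X; rewrite card_rVF2 card_vspaceF2.
  have : (2 ^ \dim X * 2 <= 2 ^ (\dim X + j.+1))%N.
    by rewrite mulnC -expnS leq_exp2l // addnS ltnS leq_addr.
  move/(leq_mul (leqnn #|~: M|)).
  move: M_dense; move: (2 ^ (_ + _))%N (2 ^ \dim X)%N #|~: M| => b a m; lia.
have [||X2 [U2 [X1X2 dimX2 dimU2 MX2]]] := d1P n M X1 U1 M0 MX1.
- by rewrite dimU1.
- by rewrite dimX1 addSnnS.
exists X2, U2; split=> //; first exact: subv_trans X1X2.
by rewrite dimX2 dimX1 addSnnS.
Qed.

Lemma blowup_of_dense_subset t q : exists r0, forall n (E M : {set 'rV['F_2]_n}),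
    (r0 <= n)%N -> E \subset M -> (2 ^ n <= q * #|E|)%N ->
  exists p (U : {vspace 'rV['F_2]_n}), [/\ p \in E, \dim U = t & blowup M <[p]> U].
Proof.
have [d0 d0P] := dense_affine_subspace t q; exists d0 => n E M d0n EM E_dense.
have [|||p [U [_ dimU /translates_inP pU]]] := d0P n E fullv.
- by rewrite dim_rVfull.
- by move=> x _; apply: memvf.
- by rewrite card_vspaceF2 dim_rVfull.
exists p, U; split=> //; first by rewrite -[p]addr0 pU ?mem0v.
by move=> _ u /vlineF2P[]->; rewrite ?eqxx // => _ /pU; apply: (subsetP EM).
Qed.

Lemma blowup_free_ordinary_point c t q : exists d0, forall n
    (M : {set 'rV['F_2]_n}) p (U : {vspace 'rV['F_2]_n}), 0 \notin M -> p \in M ->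
    (2 * 2 ^ c * #|~: M| <= 3 * 2 ^ n)%N -> blowup_free M c.+1 t ->
    blowup M <[p]> U -> (d0 <= \dim U)%N ->
  ordinary_point M c q p.
Proof.
have [d1 d1P] := blowup_extend t q.
have [d2 d2P] := blowup_extend_iter c.-1 d1.
exists (maxn t d2) => n M p U M0 pM M_dense Mfree MpU.
rewrite geq_max => /andP[tU d2U].
have dim_p : \dim <[p]> = 1%N.
  by rewrite dim_vline (_ : p != 0) //; apply: contraNneq M0 => <-.
case: c => [|c] in d2P M_dense Mfree *; first by case: (Mfree _ U dim_p tU).
have [|X [U' [pX dimX dimU' MXU']]] := d2P n M <[p]>%VS U M0 MpU d2U.
  by rewrite dim_p.
exists X; split; rewrite ?dimX ?dim_p ?memvE //.
rewrite leqNgt; apply/negP => /ltnW X_popular.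
have [X' [U'' [_ dimX' dimU'' MX']]] := d1P n M X U' M0 MXU' dimU' X_popular.
by apply: (Mfree X' U''); rewrite ?dimX' ?dimX ?dim_p ?dimU''.
Qed.

Lemma few_exceptional_points c t q : exists r0, forall n (M : {set 'rV['F_2]_n}),
    (r0 <= n)%N -> 0 \notin M -> (2 * 2 ^ c * #|~: M| <= 3 * 2 ^ n)%N ->
    blowup_free M c.+1 t ->
  exists E : {set 'rV['F_2]_n}, (q * #|E| <= 2 ^ n)%N /\
    forall p, p \in M -> p \notin E -> ordinary_point M c q p.
Proof.
have [d0 d0P] := blowup_free_ordinary_point c t q.
have [r0 r0P] := blowup_of_dense_subset d0 q.
exists r0 => n M r0n M0 M_dense Mfree.
pose E := [set p in M | ~~ `[< ordinary_point M c q p >]].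
exists E; split; last first.
  by move=> p pM; rewrite inE pM negbK => /asboolP.
rewrite leqNgt; apply/negP => /ltnW E_dense.
have EM : E \subset M by apply/subsetP=> p /setIdP[].
have [p [U [pE dimU MpU]]] := r0P n E M r0n EM E_dense.
have /setIdP[pM /asboolP p_exceptional] := pE.
by apply: p_exceptional; apply: d0P MpU _; rewrite ?dimU.
Qed.

(* For an ordinary point [p], almost every translate of [X] meets the complement
   of [M]; as [#|X|] times the size of the complement is about [2 ^ n], almost
   every translate meets it exactly once, and then not at both [h] and
   [h + p]. *)
Lemma blowup_free_complement (R : archiRealFieldType) (c t : nat) (eta : R) :
    0 < eta -> eta <= 1 / 2 ->
  exists r0, forall n (M : {set 'rV['F_2]_n}), (r0 <= n)%N -> 0 \notin M ->
    blowup_free M c.+1 t -> 2 ^+ c * #|~: M|%:R <= (1 + eta) * 2 ^+ n ->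
  (1 - eta) * 2 ^+ n <= 2 ^+ c * #|~: M|%:R /\
  exists E : {set 'rV['F_2]_n}, #|E|%:R <= eta * 2 ^+ n /\
    forall p, p \in M -> p \notin E ->
      #|self_overlap (~: M) p|%:R <= 2 * eta * 2 ^+ n.
Proof.
move=> eta_gt0 eta_small; pose q := Num.bound eta^-1.
have q_eta : 1 <= q%:R * eta.
  by rewrite -ler_pdivrMr // mul1r ltW // archi_boundP // invr_ge0 ltW.
have [r0 r0P] := few_exceptional_points c t q.
exists r0 => n M r0n M0 Mfree; set D := ~: M => D_le.
have pow_gt0 m : 0 < 2 ^+ m :> R by rewrite exprn_gt0.
have small m : (q * m <= 2 ^ n)%N -> m%:R <= eta * 2 ^+ n.
  rewrite -(ler_nat R) natrM natrX => qm.
  have := ler_wpM2l (ltW eta_gt0) qm; apply: le_trans.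
  by rewrite mulrA ler_peMl ?ler0n // mulrC.
have [|E [/small E_small ordinary]] := r0P n M r0n M0 _ Mfree.
  rewrite -(ler_nat R) !natrM !natrX -mulrA -/D.
  by have := ler_wpM2r (ltW (pow_gt0 n)) eta_small; move: D_le; lra.
have card_MD : #|M|%:R + #|D|%:R = 2 ^+ n :> R.
  by rewrite -natrD cardsC card_rVF2 natrX.
have card_XD (X : {vspace 'rV['F_2]_n}) : \dim X = c ->
    (#|X| * #|D|)%:R = 2 ^+ c * #|D|%:R :> R.
  by move=> dimX; rewrite natrM card_vspaceF2 dimX natrX.
split; last exists E; first have [ME|/subsetPn[p pM pE]] := boolP (M \subset E).
- have : #|M|%:R <= #|E|%:R :> R by rewrite ler_nat subset_leq_card.
  have : #|D|%:R <= 2 ^+ c * #|D|%:R :> R by rewrite ler_peMl // exprn_ege1 // ler1n.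
  by lra.
- have [X [_ dimX /small few]] := ordinary p pM pE.
  have := card_translates_in M X.
  by rewrite -(ler_nat R) natrD card_XD // card_rVF2 natrX; lra.
split=> // p pM pE; have [X [pX dimX /small few]] := ordinary p pM pE.
have p_neq0 : p != 0 by apply: contraNneq M0 => <-.
have := self_overlap_translates_in M (mem0v X) pX p_neq0.
by rewrite -(ler_nat R) !natrD card_XD // card_rVF2 natrX -/D; lra.
Qed.

Lemma near_subspace (R : realFieldType) n c (D E : {set 'rV['F_2]_n}) (e : R) :
    0 < e -> 20 * 2 ^+ c * e <= 1 -> 0 \in D ->
    (1 - e) * 2 ^+ n <= 2 ^+ c * #|D|%:R <= (1 + e) * 2 ^+ n ->
    #|E|%:R <= e ^+ 2 * 2 ^+ n ->
    (forall p, p \notin D -> p \notin E ->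
       #|self_overlap D p|%:R <= e ^+ 2 * 2 ^+ n) ->
  exists L : {vspace 'rV['F_2]_n}, (\dim L + c = n)%N /\
    #|symdiff D [set x in L]|%:R <= 3 * (e * 2 ^+ n).
Proof.
set g := 2 ^+ n => e_gt0 e_small D0 /andP[D_ge D_le] E_small unpopular.
have g_gt0 : 0 < g by rewrite exprn_gt0.
have C_ge1 : 1 <= 2 ^+ c :> R by rewrite exprn_ege1 // ler1n.
have C_gt0 : 0 < 2 ^+ c :> R := lt_le_trans ltr01 C_ge1.
have e_le : 20 * e <= 1.
  by apply: le_trans e_small; rewrite ler_pM2r // ler_peMr.
have Ceg : 20 * (2 ^+ c * (e * g)) <= g.
  by have := ler_wpM2r (ltW g_gt0) e_small; rewrite mul1r -!mulrA.
have eg : 20 * (e * g) <= g by have := ler_wpM2r (ltW g_gt0) e_le; lra.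
have D_large : 10 * (e * g) <= #|D|%:R by rewrite -(ler_pM2l C_gt0); lra.
have [|||H [H0 HB]] := @near_subgroup R _ D E e e_gt0 D0;
  rewrite ?card_rVF2 ?natrX -/g // => DH_close.
have [L H_eq] := vspace_of_subr_closed H0 HB.
exists L; rewrite -H_eq; split=> //.
have scaled_close := ler_wpM2l (ltW C_gt0) DH_close.
have scaled_le (A B : {set 'rV['F_2]_n}) :
    2 ^+ c * #|A|%:R <= 2 ^+ c * #|B|%:R + 2 ^+ c * #|symdiff A B|%:R :> R.
  by rewrite -mulrDr ler_pM2l // -natrD ler_nat leq_card_symdiff.
have H_le := scaled_le H D; rewrite symdiffC in H_le; have H_ge := scaled_le D H.
have cardL : #|L| = #|H| by rewrite H_eq cardsE.
by apply: dimv_of_card; rewrite -(ltr_nat R) cardL !natrM !natrX -/g; lra.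
Qed.

Lemma blowup_free_stability (R : archiRealFieldType) (c t : nat) (eps : R) :
    0 < eps ->
  exists (delta : R) (r0 : nat), 0 < delta /\
    forall n (M : {set 'rV['F_2]_n}), (r0 <= n)%N -> 0 \notin M ->
      blowup_free M c.+1 t -> 2 ^+ c * #|~: M|%:R <= (1 + delta) * 2 ^+ n ->
    exists L : {vspace 'rV['F_2]_n}, (\dim L + c)%N = n /\
      #|symdiff M [set x | x \notin L]|%:R < eps * 2 ^+ n.
Proof.
move=> eps_gt0; have C_gt0 : 0 < 2 ^+ c :> R by rewrite exprn_gt0.
pose e := Num.min (20 * 2 ^+ c)^-1 (eps / 4).
have e_gt0 : 0 < e by rewrite lt_min invr_gt0 divr_gt0 ?mulr_gt0.
have e_small : 20 * 2 ^+ c * e <= 1.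
  by rewrite -ler_pdivlMl ?mulr_gt0 // mulr1 ge_min lexx.
have e_eps : 4 * e <= eps by rewrite -ler_pdivlMl // mulrC ge_min lexx orbT.
have e_le1 : e <= 1.
  apply: le_trans e_small; rewrite ler_peMl ?(ltW e_gt0) //.
  by rewrite mulr_ege1 ?exprn_ege1 ?ler1n.
have sqr_le : e ^+ 2 <= e by rewrite expr2 ler_piMr // ltW.
have eta_gt0 : 0 < e ^+ 2 / 2 by rewrite divr_gt0 ?exprn_gt0.
have eta_small : e ^+ 2 / 2 <= 1 / 2 by lra.
have [r0 r0P] := blowup_free_complement c t eta_gt0 eta_small.
exists (e ^+ 2 / 2), r0; split=> // n M r0n M0 Mfree D_le.
have [D_ge [E [E_small unpopular]]] := r0P n M r0n M0 Mfree D_le.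
have g_gt0 : 0 < 2 ^+ n :> R by rewrite exprn_gt0.
have sqr_g := ler_wpM2r (ltW g_gt0) sqr_le.
have eg_gt0 : 0 < e * 2 ^+ n by rewrite mulr_gt0.
have e2g_gt0 : 0 < e ^+ 2 * 2 ^+ n by rewrite mulr_gt0 ?exprn_gt0.
have [||||L [dimL ML_close]] := @near_subspace R n c (~: M) E e e_gt0 e_small.
- by rewrite inE.
- by apply/andP; split; lra.
- by lra.
- move=> p; rewrite inE negbK => pM pE.
  by have := unpopular p pM pE; lra.
exists L; split=> //.
have -> : [set x | x \notin L] = ~: [set x in L] by apply/setP=> x; rewrite !inE.
rewrite -symdiff_setC setCK; apply: le_lt_trans ML_close _.
by have := ler_wpM2r (ltW g_gt0) e_eps; lra.
Qed.

Lemma blowup_embedding k n (N : {set 'rV['F_2]_k}) (W : {vspace 'rV['F_2]_k})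
    (M : {set 'rV['F_2]_n}) (X U : {vspace 'rV['F_2]_n}) :
    0 \notin M -> blowup M X U -> (forall x, x \in N -> x \notin W) ->
    (\dim W <= \dim U)%N -> (k - \dim W)%N = \dim X ->
  exists2 f : 'Hom('rV['F_2]_k, 'rV['F_2]_n), injective f
    & forall x, x \in N -> f x \in M.
Proof.
move=> M0 MXU NW dimW dimX.
have [T TU dimT] := exists_subv_dim dimW.
have [|f [fW fWc]] := exists_lfun_direct_sum (capv_compl W) (esym dimT) (B2 := X).
  by rewrite dimv_compl dim_rVfull.
have XT : (T :&: X = 0)%VS.
  by apply/eqP; rewrite -subv0 -(blowup_cap M0 MXU) capvC capvS.
have f_inj : lker f == 0%VS.
  rewrite lker0_dim -(addv_complf W) limgD fW fWc !dimv_disjoint_sum ?capv_compl //.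
  by rewrite dimT dimv_compl dim_rVfull dimX.
exists f => [|v vN]; first exact/lker0P.
have /memv_addP[w wW [x xWc v_eq]] : v \in (W + W^C)%VS by rewrite addv_complf memvf.
rewrite v_eq linearD addrC MXU -?fWc ?memv_img //.
  have x_neq0 : x != 0 by apply: contraNneq (NW v vN) => x0; rewrite v_eq x0 addr0.
  by rewrite -(linear0 f) (inj_eq (lker0P f_inj)).
by apply: subvP TU _ _; rewrite -fW memv_img.
Qed.

Lemma matroid_free_blowup_free k m r (N : matroid k) (M : matroid m)
    (W : {vspace 'rV['F_2]_k}) (iota : 'Hom('rV['F_2]_r, 'rV['F_2]_m)) :
    matroid_free N M -> (forall x, x \in N -> x \notin W) -> injective iota ->
  blowup_free (iota @^-1: mset M) (k - \dim W)%N (\dim W).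
Proof.
move=> Mfree NW iota_inj X U dimX dimU MXU; apply: Mfree.
have M'0 : 0 \notin iota @^-1: mset M by rewrite inE linear0 mset_notin0.
have [f f_inj fN] := blowup_embedding M'0 MXU NW dimU (esym dimX).
exists ((iota \o f)%VF @: mset N); split.
  by apply/subsetP=> _ /imsetP[x /fN fx ->]; move: fx; rewrite inE comp_lfunE.
exists (iota \o f)%VF; split=> // x y; rewrite /= !comp_lfunE => /iota_inj.
exact: f_inj.
Qed.

Lemma critical_numberP k (N : matroid k) : is_disjoint_codim N (critical_number N).
Proof. by rewrite /critical_number; case: ex_minnP => c /asboolP. Qed.

Lemma rankP m (M : matroid m) : is_spanning_dim M (rank M).
Proof. by rewrite /rank; case: ex_minnP => d /asboolP. Qed.

Lemma rank_embedding m (M : matroid m) :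
  exists2 iota : 'Hom('rV['F_2]_(rank M), 'rV['F_2]_m), injective iota
    & mset M = iota @: (iota @^-1: mset M).
Proof.
have [T [dimT MT]] := rankP M.
have [|iota iotaT] := @exists_lfun_img _ 'rV['F_2]_(rank M) _ fullv T.
  by rewrite dim_rVfull dimT.
exists iota; first by apply/lker0P; rewrite lker0_dim iotaT dimT dim_rVfull.
apply/setP=> y; apply/idP/imsetP => [yM|[x + ->]]; last by rewrite inE.
have /memv_imgP[x _ y_eq] : y \in limg iota by rewrite iotaT MT.
by exists x; rewrite ?inE -?y_eq.
Qed.

Lemma card_setC_of_density (R : realFieldType) n chi (A : {set 'rV['F_2]_n})
    (delta : R) :
    (0 < chi)%N ->
    (1 - 2 ^ (1 - chi%:Z) - delta / 2 ^+ chi.-1) * 2 ^+ n <= #|A|%:R ->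
  2 ^+ chi.-1 * #|~: A|%:R <= (1 + delta) * 2 ^+ n.
Proof.
case: chi => // c _; rewrite (_ : 1 - c.+1%:Z = - c%:Z); last by lia.
rewrite -exprnN /= => A_dense; have C_gt0 : 0 < 2 ^+ c :> R by rewrite exprn_gt0.
have card_A : #|A|%:R + #|~: A|%:R = 2 ^+ n :> R.
  by rewrite -natrD cardsC card_rVF2 natrX.
rewrite mulrC -ler_pdivlMr // mulrAC mulrDl mul1r.
by move: A_dense; rewrite -card_A; lra.
Qed.

Theorem theorem3p2 (R : realType) (k : nat) (N : matroid k) (eps : R)
    (eps_gt0 : 0 < eps) :
  exists (delta : R) (r0 : nat),
    0 < delta /\ (0 < r0)%N /\
    forall (r m : nat) (M : matroid m),
      (r0 <= r)%N ->
      matroid_free N M ->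
      rank M = r ->
      (1 - 2 ^ (1 - (critical_number N)%:Z) - delta) * 2 ^+ r
        <= #|mset M|%:R ->
      exists (iota : {linear 'rV['F_2]_r -> 'rV['F_2]_m}) (B B0 : matroid r),
        injective iota /\
        mset M \subset [set iota x | x in [set: 'rV['F_2]_r]] /\
        is_bose_burton (critical_number N).-1 B0 /\
        matroid_iso B B0 /\
        #|symdiff (mset M) [set iota x | x in mset B]|%:R < eps * 2 ^+ r.
Proof.
have [W [codimW NW]] := critical_numberP N; set c := (critical_number N).-1.
have [delta [r0 [delta_gt0 r0P]]] := blowup_free_stability c (\dim W) eps_gt0.
exists (delta / 2 ^+ c), (maxn r0 k.+1); split; first by rewrite divr_gt0 ?exprn_gt0.
split=> [|r m M]; first by rewrite leq_max orbT.
rewrite geq_max => /andP[r0r kr] Mfree rankM; subst r => M_dense.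
have [iota iota_inj M_iota] := rank_embedding M.
have M'free := matroid_free_blowup_free Mfree NW iota_inj; rewrite codimW in M'free.
have chi_gt0 : (0 < critical_number N)%N.
  apply: blowup_free_gt0 M'free; apply: leq_trans (ltnW kr).
  by rewrite -[leqRHS](dim_rVfull 'F_2) dimvS ?subvf.
have [|||L [dimL ML]] := r0P _ (iota @^-1: mset M) r0r.
- by rewrite inE linear0 mset_notin0.
- by rewrite (prednK chi_gt0).
- rewrite M_iota (card_imset _ iota_inj) in M_dense.
  exact: card_setC_of_density chi_gt0 M_dense.
have L0 : 0 \notin [set x | x \notin L] by rewrite inE negbK mem0v.
exists iota, (Matroid L0), (Matroid L0); split=> //.
split; first by rewrite M_iota imsetS // subsetT.
split; first by exists L.
split; first by exists idfun; split; [exists id | exact: imset_id].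
by rewrite M_iota symdiff_imset ?(card_imset _ iota_inj).
Qed.
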